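(* Let $k \ge 1$ be an integer, let $n = 2k$, and let $A = [a_{i,j}]$ be the $n \times n$ matrix with $a_{i,i+1} = a_{i+1,i} = 1$ for $i = 1,3,5,\ldots,n-1$, $a_{i,i} = 1$ for $i = 2,4,6,\ldots,n$, and all other entries $0$. Let $\alpha = \frac{1+\sqrt5}{2}$ and $\beta = \frac{1-\sqrt5}{2}$. For every positive integer $r$, write $A^r = [a_{i,j}(r)]_{n\times n}$. Then for each $i \in \{2,4,6,\ldots,n\}$, $$a_{i-1,i-1}(r) = \frac{1}{\alpha-\beta}\left(-\beta\alpha^{r} + \alpha\beta^{r}\right), \qquad a_{i,i}(r) = \frac{1}{\alpha-\beta}\left(\alpha^{r+1} - \beta^{r+1}\right),$$ $$a_{i-1,i}(r) = \frac{1}{\alpha-\beta}\left(\alpha^{r} - \beta^{r}\right), \qquad a_{i,i-1}(r) = \frac{1}{\alpha-\beta}\left(-\beta\alpha^{r+1} + \alpha\beta^{r+1}\right),$$ and all other entries of $A^r$ are $0$.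
   Context: The matrix $A$ is the block-diagonal matrix with $k$ diagonal blocks equal to $\begin{pmatrix}0&1\\1&1\end{pmatrix}$; it is the adjacency matrix of the graph on $2k$ vertices consisting of $k$ connected components, each being a single edge with a loop at one of its endpoints. The notation $a_{i,j}(r)$ denotes the $(i,j)$ entry of $A^r$. *)

(* Defs.v *)
From mathcomp Require Import all_boot all_order all_algebra.

Set Implicit Arguments.
Unset Strict Implicit.
Unset Printing Implicit Defensive.

Import Order.TTheory GRing.Theory Num.Theory.

Local Open Scope ring_scope.

(* Ordinals are 0-based; [pos i] is the index in {1, ..., n} of the
   row or column [i]. *)
Definition pos (n : nat) (i : 'I_n) : nat := i.+1.

(* Block-diagonal with k blocks (0 1; 1 1): the adjacency matrix of k disjoint
   edges {i - 1, i}, i even, each with a loop at i. *)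
Definition loop_edge_mx (R : pzRingType) (k : nat) : 'M[R]_(2 * k) :=
  \matrix_(i, j)
    (if [|| odd (pos i) && (pos j == (pos i).+1),
            odd (pos j) && (pos i == (pos j).+1)
          | ~~ odd (pos i) && (pos j == pos i)]
     then 1 else 0).

Definition alpha (R : rcfType) : R := (1 + Num.sqrt 5%:R) / 2%:R.
Definition beta (R : rcfType) : R := (1 - Num.sqrt 5%:R) / 2%:R.

(* [p] and [q] are the positions i - 1 and i, for some even i. *)
Definition edge_pair (n : nat) (p q : 'I_n) : Prop :=
  ~~ odd (pos q) /\ pos q = (pos p).+1.

(* Main.v *)
(* Left multiplication by A sends the pair of rows (x_p, x_q) of each block to
   (x_q, x_p + x_q), so the entries of A^r obey the Fibonacci recurrence inside
   a block, alpha and beta being the roots of X^2 = X + 1. *)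

Require Import Defs.
From mathcomp Require Import all_boot all_order all_algebra.
From mathcomp Require Import ring zify.

Set Implicit Arguments.
Unset Strict Implicit.
Unset Printing Implicit Defensive.

Import Order.TTheory GRing.Theory Num.Theory.

Local Open Scope ring_scope.

Lemma alpha_sqr (R : rcfType) : alpha R ^+ 2 = alpha R + 1.
Proof.
have s5 : Num.sqrt 5 ^+ 2 = 5 :> R by rewrite sqr_sqrtr ?ler0n.
by rewrite /alpha; field: s5.
Qed.

Lemma beta_sqr (R : rcfType) : beta R ^+ 2 = beta R + 1.
Proof.
have s5 : Num.sqrt 5 ^+ 2 = 5 :> R by rewrite sqr_sqrtr ?ler0n.
by rewrite /beta; field: s5.
Qed.

Lemma alphaBbeta_neq0 (R : rcfType) : alpha R - beta R != 0.
Proof.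
have -> : alpha R - beta R = Num.sqrt 5 by rewrite /alpha /beta; field.
by rewrite gt_eqF // sqrtr_gt0 ltr0n.
Qed.

(** Passing from [pos] to the 0-based value flips parity: the loop sits at an odd value. *)
Lemma edge_pair_val (n : nat) (p q : 'I_n) :
  edge_pair p q -> ~~ odd p /\ q = p.+1 :> nat.
Proof. by rewrite /edge_pair /pos /= negbK => -[oq [qE]]; rewrite qE in oq *. Qed.

(** The two 0-based indices of a block are 2m and 2m + 1, so [./2] serves as a block label, and
    lying in different blocks becomes an inequality of numbers. *)
Lemma edge_pair_half (k : nat) (i : 'I_(2 * k)) :
  exists p q : 'I_(2 * k),
    [/\ edge_pair p q, i = p \/ i = q, p./2 = i./2 & q./2 = i./2].
Proof.
have lt_i := ltn_ord i.
(* The witnesses are 2m and 2m + 1 with m = [i./2]; the second stays in range because the bound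
   [2 * k] is even. *)
have lt_p : (i./2.*2 < 2 * k)%N by lia.
have lt_q : (i./2.*2.+1 < 2 * k)%N by lia.
exists (Ordinal lt_p), (Ordinal lt_q); split => /=; [| |lia|lia].
  by rewrite /edge_pair /pos /= negbK odd_double.
have [i_odd|i_even] := boolP (odd i); [right|left]; apply/val_inj => /=; lia.
Qed.

Section LoopEdgePowers.

Variables (R : pzRingType) (k : nat).

Local Notation A := (loop_edge_mx R k).

Lemma loop_edge_mxE (p q : 'I_(2 * k)) : edge_pair p q ->
  forall l, A p l = (l == q)%:R /\ A q l = (l == p)%:R + (l == q)%:R.
Proof.
move=> /edge_pair_val[p_even qE] l.
rewrite !mxE -!val_eqE /pos /=; split.
  set c := (X in if X then _ else _).
  have -> : c = (l == q :> nat) by rewrite /c; lia.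
  by rewrite [RHS]mulrb.
set c := (X in if X then _ else _).
have -> : c = (l == p :> nat) || (l == q :> nat) by rewrite /c; lia.
(* As [p] and [q] differ, the two deltas are never both 1, so their sum is the indicator of the
   disjunction. *)
have [->|_] := eqVneq (l : nat) p; last by rewrite add0r [RHS]mulrb.
by rewrite (_ : (p == q :> nat) = false) ?addr0 //; lia.
Qed.

Lemma loop_edge_mx_mul (M : 'M[R]_(2 * k)) (p q : 'I_(2 * k)) :
  edge_pair p q -> forall j,
    (A * M) p j = M q j /\ (A * M) q j = M p j + M q j.
Proof.
have sum_delta (x j : 'I_(2 * k)) : \sum_l (l == x)%:R * M l j = M x j.
  rewrite (bigD1 x) //= eqxx mul1r big1 ?addr0 // => l /negbTE->.
  by rewrite mul0r.
move=> /loop_edge_mxE AE j; rewrite !mxE; split.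
  by rewrite -[RHS]sum_delta; apply: eq_bigr => l _; have [-> _] := AE l.
rewrite -2![in RHS]sum_delta -big_split /=; apply: eq_bigr => l _.
by have [_ ->] := AE l; rewrite mulrDl.
Qed.

(** Left multiplication by [A] mixes only rows of the same block, so zeros of the identity outside
    the blocks persist. The column [j] stays fixed while the row varies in the induction. *)
Lemma loop_edge_mx_exp_eq0 (r : nat) (i j : 'I_(2 * k)) :
  i./2 != j./2 -> (A ^+ r) i j = 0.
Proof.
elim: r i => [|r IHr] i neq_ij.
  rewrite expr0 mxE; case: eqVneq => // ij.
  by rewrite ij eqxx in neq_ij.
rewrite exprS.
have [p [q [pq i_pq pi qi]]] := edge_pair_half i.
have [Ep Eq] := loop_edge_mx_mul (A ^+ r) pq j.
have p0 : (A ^+ r) p j = 0 by apply: IHr; rewrite pi.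
have q0 : (A ^+ r) q j = 0 by apply: IHr; rewrite qi.
by case: i_pq => ->; rewrite ?Ep ?Eq ?p0 ?q0 ?addr0.
Qed.

End LoopEdgePowers.

(** The four formulas are proved together because each new entry is built from old entries of both
    rows. They already hold at [r = 0], where the induction starts. *)
Lemma loop_edge_mx_exp (R : rcfType) (k r : nat) (p q : 'I_(2 * k)) :
  let A := loop_edge_mx R k in let a := alpha R in let b := beta R in
  edge_pair p q ->
  [/\ (A ^+ r) p p = 1 / (a - b) * (- b * a ^+ r + a * b ^+ r),
      (A ^+ r) q q = 1 / (a - b) * (a ^+ r.+1 - b ^+ r.+1),
      (A ^+ r) p q = 1 / (a - b) * (a ^+ r - b ^+ r)
    & (A ^+ r) q p = 1 / (a - b) * (- b * a ^+ r.+1 + a * b ^+ r.+1)].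
Proof.
move=> A a b pq.
have ab0 : a - b != 0 := alphaBbeta_neq0 R.
have a_rec n : a ^+ n.+2 = a ^+ n.+1 + a ^+ n.
  by rewrite -addn2 exprD alpha_sqr mulrDr mulr1 -exprSr.
have b_rec n : b ^+ n.+2 = b ^+ n.+1 + b ^+ n.
  by rewrite -addn2 exprD beta_sqr mulrDr mulr1 -exprSr.
(* From here on, only [a - b != 0] and the two recurrences are used about [a] and [b]. *)
clearbody a b; elim: r => [|r [IHpp IHqq IHpq IHqp]].
  have [_ qE] := edge_pair_val pq.
  have p_neq_q : p != q by rewrite -val_eqE /= qE; lia.
  rewrite expr0 !mxE !eqxx (negbTE p_neq_q) eq_sym (negbTE p_neq_q).
  by rewrite mulr1n mulr0n; split; field.
rewrite exprS.
have [pE qE] := loop_edge_mx_mul (A ^+ r) pq p.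
have [pE' qE'] := loop_edge_mx_mul (A ^+ r) pq q.
(* The new row [p] is the old row [q], and its formulas agree literally; only the two entries of row
   [q] need the recurrences. *)
rewrite {}pE {}qE {}pE' {}qE' IHpp IHqq IHpq IHqp; split=> //.
  by rewrite a_rec b_rec; ring.
by rewrite (a_rec r) (b_rec r); ring.
Qed.

Theorem mainTheorem1 (R : rcfType) (k : nat) (hk : (1 <= k)%N)
    (r : nat) (hr : (1 <= r)%N) :
  let A : 'M[R]_(2 * k) := loop_edge_mx R k in
  let a := alpha R in
  let b := beta R in
  (forall p q : 'I_(2 * k), edge_pair p q ->
     [/\ (A ^+ r) p p = 1 / (a - b) * (- b * a ^+ r + a * b ^+ r),
         (A ^+ r) q q = 1 / (a - b) * (a ^+ r.+1 - b ^+ r.+1),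
         (A ^+ r) p q = 1 / (a - b) * (a ^+ r - b ^+ r)
       & (A ^+ r) q p = 1 / (a - b) * (- b * a ^+ r.+1 + a * b ^+ r.+1)])
  /\
  (forall i j : 'I_(2 * k),
     ~ (exists p q : 'I_(2 * k), edge_pair p q /\
          [\/ i = p /\ j = p, i = q /\ j = q,
              i = p /\ j = q | i = q /\ j = p]) ->
     (A ^+ r) i j = 0).
Proof.
move=> A a b; split=> [p q|i j not_block]; first exact: loop_edge_mx_exp.
(* By contraposition: if [i] and [j] had equal halves, both would belong to the pair [p], [q] of
   that block. *)
apply: loop_edge_mx_exp_eq0; apply/eqP => ij; apply: not_block.
have [p [q [pq i_pq pi qi]]] := edge_pair_half i.
exists p, q; split=> //.
have [p_even qE] := edge_pair_val pq.
have j_pq : j = p \/ j = q.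
  by have [|] := boolP (odd j); [right|left]; apply/val_inj => /=; lia.
by case: i_pq j_pq => [ip|iq] [jp|jq];
  [apply: Or41|apply: Or43|apply: Or44|apply: Or42].
Qed.
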